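(* Let $n\ge 1$ and $d\ge 1$ be integers, and let $f,g\in\mathbb{C}[x_1,\ldots,x_n]_d$ be homogeneous polynomials of degree $d$. If the Milnor algebras $M(f)$ and $M(g)$ are isomorphic as graded $\mathbb{C}$-algebras, then $f$ and $g$ are right-equivalent, $f\stackrel{\mathcal{R}}{\sim}g$.
   Context: $\mathbb{C}[x_1,\ldots,x_n]_d$ (also denoted $H^d(n,1;\mathbb{C})$) is the complex vector space of homogeneous polynomials of degree $d$ in $x_1,\ldots,x_n$ (including $0$). For $f\in\mathbb{C}[x_1,\ldots,x_n]_d$, the Jacobian ideal is $\mathcal{J}_f=\left\langle \frac{\partial f}{\partial x_1},\ldots,\frac{\partial f}{\partial x_n}\right\rangle\subset\mathbb{C}[x_1,\ldots,x_n]$, a homogeneous ideal, and the Milnor algebra is the quotient $M(f)=\mathbb{C}[x_1,\ldots,x_n]/\mathcal{J}_f$ with the grading induced by the standard grading ($\deg x_i=1$). An isomorphism of graded $\mathbb{C}$-algebras is a degree-preserving $\mathbb{C}$-algebra isomorphism. No assumption of isolated singularities at the origin is made, so $M(f)$ may be infinite-dimensional. Right equivalence $f\stackrel{\mathcal{R}}{\sim}g$ on $\mathbb{C}[x_1,\ldots,x_n]_d$ means that $f$ and $g$ lie in the same orbit of the action of $GL(n,\mathbb{C})$ by linear change of coordinates, i.e. there is a linear isomorphism $u:\mathbb{C}^n\to\mathbb{C}^n$ with $f=g\circ u$. (For homogeneous polynomials of the same degree $d\geq 1$ this is equivalent to the existence of a germ of biholomorphism $h:(\mathbb{C}^n,0)\to(\mathbb{C}^n,0)$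 with $f=g\circ h$.) *)

(* Defs.v *)
From HB Require Import structures.
From mathcomp Require Import all_boot all_order all_algebra.
From mathcomp Require Import ring_quotient.
From mathcomp Require Import boolp reals complex.
From mathcomp Require Import mpoly.

Set Implicit Arguments.
Unset Strict Implicit.
Unset Printing Implicit Defensive.

Import GRing.Theory.

Local Open Scope ring_scope.
Local Open Scope quotient_scope.

Section MilnorAlgebra.

Variables (K : fieldType) (n : nat).
Implicit Types f g p q : {mpoly K[n]}.

Definition jacobian_ideal f : {pred {mpoly K[n]}} :=
  fun p => `[< exists a : 'I_n -> {mpoly K[n]}, p = \sum_i a i * f^`M(i) >].

Fact jacobian_idealP f p :
  reflect (exists a : 'I_n -> {mpoly K[n]}, p = \sum_i a i * f^`M(i))
          (p \in jacobian_ideal f).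
Proof. exact: asboolP. Qed.

Fact jacobian_ideal_zmod f : zmod_closed (jacobian_ideal f).
Proof.
split; first by apply/jacobian_idealP; exists (fun=> 0);
  rewrite big1 // => i _; rewrite mul0r.
move=> p q /jacobian_idealP[a ->] /jacobian_idealP[b ->].
apply/jacobian_idealP; exists (fun i => a i - b i).
by rewrite -sumrB; apply: eq_bigr => i _; rewrite mulrBl.
Qed.

HB.instance Definition _ f :=
  GRing.isZmodClosed.Build {mpoly K[n]} (jacobian_ideal f)
    (jacobian_ideal_zmod f).

Fact jacobian_idealMl f p q :
  q \in jacobian_ideal f -> p * q \in jacobian_ideal f.
Proof.
move=> /jacobian_idealP[a ->]; apply/jacobian_idealP.
exists (fun i => p * a i); rewrite mulr_sumr.
by apply: eq_bigr => i _; rewrite mulrA.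
Qed.

(* The library's quotient by an ideal only covers proper ideals, whereas J_f is
   the whole ring when f is a nonzero linear form.  So M(f) is built on the
   additive quotient, as a possibly zero ring (comPzRingType). *)
Definition milnor f : Type := {ideal_quot jacobian_ideal f}.

HB.instance Definition _ f := GRing.Zmodule.on (milnor f).

Definition milnor_pi f p : milnor f := \pi_({ideal_quot jacobian_ideal f}) p.

Fact milnor_piE f p q :
  (milnor_pi f p = milnor_pi f q) <-> (p - q \in jacobian_ideal f).
Proof. by rewrite Quotient.idealrBE; split=> [/eqP|/eqP]. Qed.

Fact milnor_piP f (x : milnor f) : exists p, x = milnor_pi f p.
Proof.
by exists (repr (x : {ideal_quot jacobian_ideal f})); rewrite /milnor_pi reprK.
Qed.

Fact milnor_pi0 f : milnor_pi f 0 = 0.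
Proof. exact: raddf0. Qed.

Fact milnor_piD f : {morph milnor_pi f : p q / p + q}.
Proof. by move=> p q; exact: raddfD. Qed.

Definition milnor_one f : milnor f := milnor_pi f 1.
Definition milnor_mul f (x y : milnor f) : milnor f :=
  milnor_pi f (repr (x : {ideal_quot jacobian_ideal f}) *
               repr (y : {ideal_quot jacobian_ideal f})).
Definition milnor_scale f (c : K) (x : milnor f) : milnor f :=
  milnor_pi f (c *: repr (x : {ideal_quot jacobian_ideal f})).

Fact milnor_reprP f p :
  p - repr (milnor_pi f p : {ideal_quot jacobian_ideal f}) \in jacobian_ideal f.
Proof. by apply/milnor_piE; rewrite /milnor_pi reprK. Qed.

Fact milnor_mulE f p q :
  milnor_mul (milnor_pi f p) (milnor_pi f q) = milnor_pi f (p * q).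
Proof.
apply/esym/milnor_piE; set p' := repr _; set q' := repr _.
have -> : p * q - p' * q' = q * (p - p') + p' * (q - q').
  by rewrite !mulrBr [q * p]mulrC [q * p']mulrC addrA subrK.
by apply: rpredD; apply: jacobian_idealMl; apply: milnor_reprP.
Qed.

Fact milnor_scaleE f c p :
  milnor_scale c (milnor_pi f p) = milnor_pi f (c *: p).
Proof.
apply/esym/milnor_piE; rewrite -scalerBr -mul_mpolyC.
exact/jacobian_idealMl/milnor_reprP.
Qed.

Fact milnor_mulA f : associative (@milnor_mul f).
Proof.
move=> x y z; have [p ->] := milnor_piP x; have [q ->] := milnor_piP y.
by have [r ->] := milnor_piP z; rewrite !milnor_mulE mulrA.
Qed.

Fact milnor_mulC f : commutative (@milnor_mul f).
Proof.
move=> x y; have [p ->] := milnor_piP x; have [q ->] := milnor_piP y.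
by rewrite !milnor_mulE mulrC.
Qed.

Fact milnor_mul1 f : left_id (milnor_one f) (@milnor_mul f).
Proof. by move=> x; have [p ->] := milnor_piP x; rewrite milnor_mulE mul1r. Qed.

Fact milnor_mulDl f : left_distributive (@milnor_mul f) +%R.
Proof.
move=> x y z; have [p ->] := milnor_piP x; have [q ->] := milnor_piP y.
have [r ->] := milnor_piP z.
by rewrite -milnor_piD !milnor_mulE mulrDl milnor_piD.
Qed.

HB.instance Definition _ f :=
  GRing.Zmodule_isComPzRing.Build (milnor f)
    (@milnor_mulA f) (@milnor_mulC f) (@milnor_mul1 f) (@milnor_mulDl f).

Fact milnor_scaleA f a b (x : milnor f) :
  milnor_scale a (milnor_scale b x) = milnor_scale (a * b) x.
Proof. by have [p ->] := milnor_piP x; rewrite !milnor_scaleE scalerA. Qed.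

Fact milnor_scale1 f : left_id 1 (@milnor_scale f).
Proof. by move=> x; have [p ->] := milnor_piP x; rewrite milnor_scaleE scale1r. Qed.

Fact milnor_scaleDr f : right_distributive (@milnor_scale f) +%R.
Proof.
move=> a x y; have [p ->] := milnor_piP x; have [q ->] := milnor_piP y.
by rewrite -milnor_piD !milnor_scaleE scalerDr milnor_piD.
Qed.

Fact milnor_scaleDl f (x : milnor f) :
  {morph (@milnor_scale f)^~ x : a b / a + b}.
Proof.
move=> a b /=; have [p ->] := milnor_piP x.
by rewrite !milnor_scaleE scalerDl milnor_piD.
Qed.

HB.instance Definition _ f :=
  GRing.Zmodule_isLmodule.Build K (milnor f)
    (@milnor_scaleA f) (@milnor_scale1 f) (@milnor_scaleDr f) (@milnor_scaleDl f).

Fact milnor_pi1 f : milnor_pi f 1 = 1.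
Proof. by []. Qed.

Fact milnor_piM f : {morph milnor_pi f : p q / p * q}.
Proof. by move=> p q; rewrite -milnor_mulE. Qed.

Fact milnor_piZ f (c : K) : {morph milnor_pi f : p / c *: p}.
Proof. by move=> p; rewrite -milnor_scaleE. Qed.

(* The compatibility making M(f) a K-algebra; it cannot be an instance because
   lalgType requires a nonzero ring. *)
Fact milnor_scaleAl f (c : K) (x y : milnor f) : c *: (x * y) = (c *: x) * y.
Proof.
have [p ->] := milnor_piP x; have [q ->] := milnor_piP y.
by rewrite -milnor_piM -!milnor_piZ -milnor_piM scalerAl.
Qed.

Definition milnor_graded f (k : nat) (x : milnor f) : Prop :=
  exists2 p : {mpoly K[n]}, p \is k.-homog & x = milnor_pi f p.

Definition milnor_graded_isomorphic f g : Prop :=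
  exists phi : {rmorphism milnor f -> milnor g},
    [/\ bijective phi, scalable phi &
        forall k (x : milnor f), milnor_graded k x -> milnor_graded k (phi x)].

(* f = g o u, where u is the linear map v |-> A v on column vectors. *)
Definition right_equivalent f g : Prop :=
  exists2 A : 'M[K]_n, A \in unitmx &
    f = g \mPo [tuple \sum_(j < n) A i j *: 'X_j | i < n].

End MilnorAlgebra.

(* Main.v *)
(* A graded isomorphism M(f) -> M(g) is induced by a substitution of linear forms,
   determined only modulo J_g in degree 1; since matrix rings over a field have
   stable range 1, that substitution L can be chosen invertible.  Then h = f o L
   satisfies J_h = J_g, so comparing components of degree d - 1 (and using stable
   range 1 again) grad h = A grad g with A invertible.  As the Hessian of h is
   symmetric, A H_g = H_g A^T: in terms of the polarization G of g, A^T is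
   self-adjoint for G(-, -, x, ..., x), hence so is every polynomial in A^T.  Over
   an algebraically closed field of characteristic 0, A^T has a d-th root B that
   is such a polynomial, and moving the copies of B to one slot,
   g(Bx) = G(Bx, ..., Bx) = G(A^T x, x, ..., x) = x . A grad g / d = h(x).
   This replaces the tangent space argument for Lie group orbits. *)
Require Import Defs.
From mathcomp Require Import all_boot all_order all_algebra.
From mathcomp Require Import reals complex mpoly.
Set Implicit Arguments.
Unset Strict Implicit.
Unset Printing Implicit Defensive.
Import GRing.Theory.
Local Open Scope ring_scope.

(** * Matrices over a field: stable range 1 and roots of invertible matrices *)

(* If L = P I_r Q with P, Q invertible, and D = 1 - I_r, then Z = P D Q works,
   because D Q X P I_r squares to 0. *)
Lemma unitmx_stable_range (F : fieldType) n (X L : 'M[F]_n) :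
  exists Z : 'M[F]_n, L + Z *m (1%:M - X *m L) \in unitmx.
Proof.
pose P := col_ebase L; pose Q := row_ebase L; pose r := \rank L.
have uP : P \in unitmx by apply: col_ebase_unit.
have uQ : Q \in unitmx by apply: row_ebase_unit.
have defL : L = P *m pid_mx r *m Q by rewrite mulmx_ebase.
(* [D] is opaque so that [mulmxBr] does not distribute over [copid_mx]. *)
have [D DE] : exists D : 'M[F]_n, D = copid_mx r by exists (copid_mx r).
pose U := D *m Q *m X *m P *m (pid_mx r : 'M[F]_n).
have U2 : U *m U = 0.
  rewrite /U -!mulmxA [pid_mx r *m (D *m _)]mulmxA DE mul_pid_mx_copid ?rank_leq_col //.
  by rewrite mul0mx !mulmx0.
have uU : 1%:M - U \in unitmx.
  suff /mulmx1_unit[] : (1%:M - U) *m (1%:M + U) = 1%:M by [].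
  by rewrite mulmxDr mulmx1 mulmxBl mul1mx U2 subr0 subrK.
exists (P *m D *m Q).
(* Indeed L + P D Q = P Q, and P D Q X L = P U Q. *)
suff -> : L + P *m D *m Q *m (1%:M - X *m L) = P *m (1%:M - U) *m Q.
  by rewrite !unitmx_mul uP uU uQ.
have LD : L = P *m Q - P *m D *m Q.
  by rewrite -mulmxBl -{1}[P]mulmx1 -mulmxBr DE subKr.
by rewrite {1}LD defL !mulmxBr !mulmxBl !mulmx1 !mulmxA addrA subrK.
Qed.

(* Correcting p by a multiple c q of the modulus q already treated adds one linear
   factor: c is found by interpolation if a is a new root, and by a Newton step if
   q.[a] = 0. *)
Lemma poly_root_mod (F : closedFieldType) d (rs : seq F) :
  d.+1%:R != 0 :> F -> 0 \notin rs ->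
  exists p : {poly F}, \prod_(a <- rs) ('X - a%:P) %| p ^+ d.+1 - 'X.
Proof.
move=> d0; elim: rs => [|a rs IH] /=; first by exists 0; rewrite big_nil dvd1p.
rewrite inE negb_or eq_sym => /andP[a0 /IH[p]] {IH}.
set q := \prod_(_ <- _) _ => /dvdpP[h ph].
pose S c := \sum_(i < d.+1) (p + c *: q) ^+ (d - i) * p ^+ i.
have expS c : (p + c *: q) ^+ d.+1 - 'X = (h + c *: S c) * q.
  have -> : (h + c *: S c) * q = h * q + (p + c *: q - p) * S c.
    by rewrite [p + _]addrC addrK mulrDl -!scalerAl [q * _]mulrC.
  by rewrite -ph -subrXX [RHS]addrC addrA subrK.
suff [c rc] : exists c, root (h + c *: S c) a.
  exists (p + c *: q); rewrite big_cons -/q expS dvdp_mul ?dvdpp //.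
  by rewrite dvdp_XsubCl.
have [qa|qa] := eqVneq q.[a] 0; last first.
  have [b rb] : exists b, root ('X^(d.+1) - a%:P) b.
    by apply/closed_rootP; rewrite size_XnsubC.
  have ba : b ^+ d.+1 = a.
    by apply/eqP; move: rb; rewrite /root !hornerE subr_eq0.
  (* This [c] makes [p + c *: q] take the value [b] at [a], a root of order [d.+1] of [a]; since
     [q.[a]] is nonzero, the cofactor of [q] must vanish there. *)
  exists ((b - p.[a]) / q.[a]); set c := _ / _.
  have := congr1 (horner^~ a) (expS c); rewrite hornerM hornerD hornerN horner_exp.
  rewrite hornerD hornerZ hornerX divfK // [p.[a] + _]addrC subrK ba subrr => /esym/eqP.
  by rewrite mulf_eq0 (negPf qa) orbF.
have pa : p.[a] ^+ d.+1 = a.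
  have := congr1 (horner^~ a) ph.
  by rewrite hornerM qa mulr0 !hornerE => /eqP; rewrite subr_eq0 => /eqP.
have pa0 : p.[a] != 0 by apply: contraNneq a0 => pa0; rewrite -pa pa0 expr0n.
(* As [q.[a]] is 0, [S c] takes at [a] the value of the derivative of X^(d+1) at [p.[a]]. It is
   nonzero and independent of [c], so the condition on [c] is a solvable linear equation. *)
have Sa c : (S c).[a] = d.+1%:R * p.[a] ^+ d.
  rewrite horner_sum mulr_natl -[in RHS](card_ord d.+1) -sumr_const.
  apply: eq_bigr => i _; rewrite hornerM !horner_exp hornerD hornerZ qa mulr0 addr0.
  by rewrite -exprD subnK // -ltnS.
exists (- h.[a] / (d.+1%:R * p.[a] ^+ d)).
by rewrite /root hornerD hornerZ Sa divfK ?subrr // ?addrN // mulf_neq0 ?expf_neq0.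
Qed.

(** By Cayley-Hamilton it suffices to find a root of X modulo the characteristic polynomial, which
    does not vanish at 0 because [A] is invertible. *)
Lemma unitmx_poly_root (F : closedFieldType) n d (A : 'M[F]_n.+1) :
  d.+1%:R != 0 :> F -> A \in unitmx -> exists p, horner_mx A p ^+ d.+1 = A.
Proof.
move=> d0 uA; have [rs Drs] := closed_field_poly_normal (char_poly A).
rewrite (monicP (char_poly_monic A)) scale1r in Drs.
have [|p /dvdpP[h hp]] := @poly_root_mod F d rs d0.
  rewrite -root_prod_XsubC -Drs; apply: contraL uA => r0.
  move: r0; rewrite -eigenvalue_root_char => /eigenvalueP[v].
  rewrite scale0r => vA v0; apply: contraNN v0 => uA.
  by rewrite -[v](mulmxK uA) vA mul0mx.
exists p; apply/eqP; rewrite -subr_eq0 -rmorphXn -[X in _ - X](horner_mx_X A) -rmorphB.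
by rewrite hp -Drs rmorphM /= Cayley_Hamilton mulr0.
Qed.

(** * Matrices acting on families of vectors *)

Section LinearCombinations.

Variables (K : comNzRingType) (V : lmodType K) (n : nat).
Implicit Types (A B : 'M[K]_n) (v : 'I_n -> V) (i : 'I_n).

(** The module is arbitrary so that the same rules serve the variables and the gradient of a
    polynomial. *)
Definition lincomb A v i : V := \sum_j A i j *: v j.

Lemma lincombM A B v i : lincomb (A *m B) v i = lincomb A (lincomb B v) i.
Proof.
under [RHS]eq_bigr do rewrite scaler_sumr.
rewrite exchange_big; apply: eq_bigr => j _; rewrite mxE scaler_suml.
by apply: eq_bigr => k _; rewrite scalerA.
Qed.

Lemma lincomb1 v i : lincomb 1%:M v i = v i.
Proof.
rewrite /lincomb (bigD1 i) //= mxE eqxx scale1r big1 ?addr0 // => j ne.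
by rewrite mxE eq_sym (negPf ne) scale0r.
Qed.

Lemma lincombB A B v i : lincomb (A - B) v i = lincomb A v i - lincomb B v i.
Proof. by rewrite -sumrB; apply: eq_bigr => j _; rewrite !mxE scalerBl. Qed.

End LinearCombinations.

(** * Linear substitutions, partial derivatives and homogeneous components *)

Section LinearSubstitution.

Variables (K : fieldType) (n : nat).
Implicit Types (A B M : 'M[K]_n) (p q : {mpoly K[n]}) (i j k : 'I_n).

Definition linform M : 'I_n -> {mpoly K[n]} := lincomb M (fun j => 'X_j).

Definition linsubst M : n.-tuple {mpoly K[n]} := [tuple linform M i | i < n].

Lemma mpoly_horner_ind (P : {mpoly K[n]} -> Prop) :
  (forall c, P c%:MP) -> (forall p q, P p -> P q -> P (p + q)) ->
  (forall i p, P p -> P ('X_i * p)) -> forall p, P p.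
Proof.
move=> PC PD PX; have PM q : P q -> forall m, P ('X_[m] * q).
  move=> Pq m; rewrite mpolyXE_id; elim/big_rec: _ => [|i x _ IH].
    by rewrite mul1r.
  elim: (m i) => [|e IHe]; first by rewrite expr0 mul1r.
  by rewrite exprS -!mulrA; apply: PX; rewrite mulrA.
elim/mpolyind=> [|c m p _ _ Pp]; first by rewrite -mpolyC0; apply: PC.
by apply: PD => //; rewrite -mul_mpolyC mulrC; apply: PM.
Qed.

Lemma mpolyXU_linsubst M i : 'X_i \mPo linsubst M = linform M i.
Proof. by rewrite comp_mpolyXU -tnth_nth tnth_mktuple. Qed.

Lemma mpolyXU_homog i : ('X_i : {mpoly K[n]}) \is 1.-homog.
Proof. by rewrite dhomogX; apply/eqP/mdeg1. Qed.

Lemma linform_homog M i : linform M i \is 1.-homog.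
Proof. by apply: rpred_sum => j _; apply/rpredZ/mpolyXU_homog. Qed.

Lemma linform_subst A B i : linform A i \mPo linsubst B = linform (A *m B) i.
Proof.
rewrite [RHS]lincombM raddf_sum /=; apply: eq_bigr => j _.
by rewrite comp_mpolyZ mpolyXU_linsubst.
Qed.

Lemma linsubstM A B p :
  (p \mPo linsubst A) \mPo linsubst B = p \mPo linsubst (A *m B).
Proof.
elim/mpoly_horner_ind: p => [c|p q IHp IHq|i p IHp].
- by rewrite !comp_mpolyC.
- by rewrite !raddfD /= IHp IHq.
- by rewrite !rmorphM /= IHp !mpolyXU_linsubst linform_subst.
Qed.

Lemma linsubst1 p : p \mPo linsubst 1%:M = p.
Proof.
rewrite -[RHS]comp_mpoly_id; congr (_ \mPo _); apply: eq_from_tnth => i.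
by rewrite !tnth_mktuple [LHS]lincomb1.
Qed.

Lemma linsubst_homog d M p : p \is d.-homog -> p \mPo linsubst M \is d.-homog.
Proof.
move/dhomogP => hp; rewrite comp_mpolyEX big_seq; apply: rpred_sum => m /hp <-.
apply: rpredZ; rewrite comp_mpolyX.
suff: \prod_i tnth (linsubst M) i ^+ m i \is (\sum_i m i).-homog by rewrite -mdegE.
elim/big_rec2: _ => [|i e q _ hq]; first exact: dhomog1.
by rewrite dhomogM // tnth_mktuple -[X in X.-homog]mul1n dhomogMn ?linform_homog.
Qed.

Lemma mderivXU i j : ('X_j : {mpoly K[n]})^`M(i) = (j == i)%:R.
Proof.
rewrite mderivX mnm1E; case: eqVneq => [->|_]; last by rewrite scale0r.
by rewrite -[X in (X - _)%MM]add0m addmK mpolyX0 scale1r.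
Qed.

Lemma mderiv_linform M i k : (linform M i)^`M(k) = (M i k)%:MP.
Proof.
rewrite raddf_sum /= (bigD1 k) //= mderivZ mderivXU eqxx alg_mpolyC.
rewrite big1 ?addr0 // => j ne.
by rewrite mderivZ mderivXU (negPf ne) scaler0.
Qed.

(** The chain rule, by Horner induction with the product rule. *)
Lemma mderiv_linsubst M p k :
  (p \mPo linsubst M)^`M(k) = \sum_i M i k *: (p^`M(i) \mPo linsubst M).
Proof.
elim/mpoly_horner_ind: p => [c|p q IHp IHq|j p IHp].
- rewrite comp_mpolyC mderivC big1 // => i _.
  by rewrite mderivC comp_mpoly0 scaler0.
- rewrite raddfD /= mderivD IHp IHq -big_split; apply: eq_bigr => i _.
  by rewrite mderivD raddfD scalerDr.
rewrite rmorphM /= mderivM IHp mpolyXU_linsubst mderiv_linform.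
under [RHS]eq_bigr do rewrite mderivM rmorphD !rmorphM /= mpolyXU_linsubst scalerDr.
rewrite big_split /=; congr (_ + _).
  rewrite (bigD1 j) //= mderivXU eqxx comp_mpoly1 mul1r mul_mpolyC.
  rewrite big1 ?addr0 // => i ne.
  by rewrite mderivXU eq_sym (negPf ne) comp_mpoly0 mul0r scaler0.
by rewrite mulr_sumr; apply: eq_bigr => i _; rewrite scalerAr.
Qed.

Lemma mderiv_homog d p i : p \is d.+1.-homog -> p^`M(i) \is d.-homog.
Proof.
move/dhomogP=> hp; rewrite /mderiv big_seq; apply: rpred_sum => m /hp dm.
have [->|mi] := eqVneq (m i) 0%N; first by rewrite mul0r scale0r rpred0.
apply: rpredZ; suff -> : d = mdeg (m - U_(i))%MM by rewrite dhomogX.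
apply: succn_inj; rewrite -[RHS]addn1 -[X in _ = (_ + X)%N](mdeg1 i) -mdegD.
by rewrite submK ?lep1mP.
Qed.

Lemma euler_homog d p :
  p \is d.-homog -> \sum_i 'X_i * p^`M(i) = d%:R *: p.
Proof.
move=> /dhomogP hp; rewrite [p in RHS]mpolyE scaler_sumr.
under eq_bigr do rewrite /mderiv mulr_sumr; rewrite exchange_big /=.
rewrite !big_seq; apply: eq_bigr => m /hp dm.
have <- : (\sum_i m i)%N = d by rewrite -mdegE.
rewrite natr_sum scaler_suml; apply: eq_bigr => i _.
rewrite -scalerAr scalerA; have [->|mi] := eqVneq (m i) 0%N.
  by rewrite mul0r !scale0r.
by rewrite -mpolyXD addmC submK // lep1mP.
Qed.

Lemma dhomog0E p : p \is 0.-homog -> p = (p@_0%MM)%:MP.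
Proof.
move=> hp; apply/mpolyP => m; rewrite mcoeffC.
have [<-|ne] := eqVneq 0%MM m; first by rewrite mulr1.
by rewrite mulr0 (dhomog_nemf_coeff hp) // mdeg_eq0 eq_sym.
Qed.

Lemma dhomog1E p : p \is 1.-homog -> p = \sum_i p@_U_(i) *: 'X_i.
Proof.
move=> hp; rewrite -[LHS]scale1r -[1]/(1%:R) -(euler_homog hp).
apply: eq_bigr => i _; have /dhomog0E -> := mderiv_homog i hp.
by rewrite mcoeff_deriv add0m mnm0E mulr1n mulrC mul_mpolyC.
Qed.

Lemma pihomogMr d e p q : q \is e.-homog ->
  pihomog mdeg (d + e) (p * q) = pihomog mdeg d p * q.
Proof.
move=> hq; elim/mpolyind: p => [|c m p _ _ IH]; first by rewrite mul0r !raddf0 mul0r.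
rewrite mulrDl !raddfD /= mulrDl IH -scalerAl !linearZ /= -scalerAl; congr (_ *: _ + _).
rewrite pihomogX; have hmq : 'X_[m] * q \is (mdeg m + e).-homog by rewrite dhomogM ?dhomogX.
case: eqVneq => [<-|ne]; first by rewrite pihomog_dE.
by rewrite mul0r (pihomog_ne0 _ hmq) // eqn_add2r.
Qed.

Lemma pihomogMr_lt d e p q : q \is e.-homog -> (d < e)%N ->
  pihomog mdeg d (p * q) = 0.
Proof.
move=> hq lt_de; elim/mpolyind: p => [|c m p _ _ IH]; first by rewrite mul0r raddf0.
rewrite mulrDl raddfD /= IH -scalerAl linearZ /= addr0.
have hmq : 'X_[m] * q \is (mdeg m + e).-homog by rewrite dhomogM ?dhomogX.
by rewrite (pihomog_ne0 _ hmq) ?scaler0 // gtn_eqF // ltn_addl.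
Qed.

Lemma pihomog_linsubst d M p :
  pihomog mdeg d (p \mPo linsubst M) = pihomog mdeg d p \mPo linsubst M.
Proof.
elim/mpolyind: p => [|c m p _ _ IH]; first by rewrite comp_mpoly0 !raddf0.
rewrite !raddfD /= IH !linearZ /=; congr (_ *: _ + _).
have hm : 'X_[m] \mPo linsubst M \is (mdeg m).-homog.
  by apply: linsubst_homog; rewrite dhomogX.
rewrite pihomogX; case: eqVneq => [<-|ne]; first by rewrite pihomog_dE.
by rewrite comp_mpoly0 (pihomog_ne0 _ hm).
Qed.

End LinearSubstitution.

(** * Matrices self-adjoint for the Hessian *)

Section Hessian.

Variables (K : fieldType) (n : nat).
Implicit Types (A M N : 'M[K]_n.+1) (p q f g : {mpoly K[n.+1]}).

Definition constmx M : 'M[{mpoly K[n.+1]}]_n.+1 := map_mx (@mpolyC _ K) M.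

Definition hessian p : 'M[{mpoly K[n.+1]}]_n.+1 := \matrix_(i, j) p^`M(i)^`M(j).

(** [M] is self-adjoint for the bilinear form given by the Hessian of [p] at a generic point. *)
Definition hessian_selfadj p M : Prop :=
  hessian p *m constmx M = (constmx M)^T *m hessian p.

Lemma hessian_selfadjP p M :
  hessian_selfadj p M <->
  forall i k, \sum_j M j k *: p^`M(i)^`M(j) = \sum_j M j i *: p^`M(k)^`M(j).
Proof.
have El i k : (hessian p *m constmx M) i k = \sum_j M j k *: p^`M(i)^`M(j).
  by rewrite mxE; apply: eq_bigr => j _; rewrite !mxE mulrC mul_mpolyC.
have Er i k :
    ((constmx M)^T *m hessian p) i k = \sum_j M j i *: p^`M(k)^`M(j).
  by rewrite mxE; apply: eq_bigr => j _; rewrite !mxE mul_mpolyC mderiv_comm.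
split=> [H i k|H]; first by rewrite -El -Er H.
by apply/matrixP => i k; rewrite El Er.
Qed.

Lemma hessian_selfadj_horner p M r :
  hessian_selfadj p M -> hessian_selfadj p (horner_mx M r).
Proof.
rewrite /hessian_selfadj => HM; elim/poly_ind: r => [|r c IH].
  by rewrite rmorph0 /constmx raddf0 trmx0 mulmx0 mul0mx.
have constmxM A B : constmx (A *m B) = constmx A *m constmx B by apply: map_mxM.
have rMC : horner_mx M r *m M = M *m horner_mx M r.
  exact/comm_mx_sym/comm_mx_horner.
have -> : constmx (horner_mx M (r * 'X + c%:P)) =
    constmx (horner_mx M r *m M) + c%:MP%:M.
  by rewrite rmorphD rmorphM /= horner_mx_X horner_mx_C -map_scalar_mx -map_mxD.
rewrite mulmxDr [(_ + _)^T]linearD /= mulmxDl tr_scalar_mx -scalar_mxC; congr (_ + _).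
(* H r(M) M = r(M)^T H M = r(M)^T M^T H; commuting [M] with r(M) on the right-hand side gives the
   transposes this order. *)
by rewrite {2}rMC !constmxM trmx_mul mulmxA IH -!mulmxA HM.
Qed.

(* The right-hand side is the derivative of p at x in the direction M^(d+1) x;
   polarization is avoided by an induction on d through the partial derivatives. *)
Lemma linsubst_selfadj d p M : [pchar K] =i pred0 ->
  p \is d.+1.-homog -> hessian_selfadj p M ->
  d.+1%:R *: (p \mPo linsubst M) = \sum_i linform (M ^+ d.+1) i * p^`M(i).
Proof.
move=> charK; have eulerM e q : q \is e.-homog ->
    e%:R *: (q \mPo linsubst M) = \sum_i linform M i * (q^`M(i) \mPo linsubst M).
  move=> hq; rewrite -comp_mpolyZ -(euler_homog hq) raddf_sum /=.
  by apply: eq_bigr => i _; rewrite rmorphM /= mpolyXU_linsubst.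
elim: d p => [|d IHd] p hp adjM.
  rewrite eulerM // expr1; apply: eq_bigr => i _.
  by have /dhomog0E -> := mderiv_homog i hp; rewrite comp_mpolyC.
(* Differentiate the coordinate identities of [adjM] in direction [k], and commute partial
   derivatives. *)
have adjdM k : hessian_selfadj p^`M(k) M.
  apply/hessian_selfadjP => i j.
  have E := congr1 (mderiv k) ((hessian_selfadjP _ _).1 adjM i j).
  rewrite !raddf_sum /= in E.
  apply: (etrans _ (etrans E _)); apply: eq_bigr => l _;
    by rewrite mderivZ [p^`M(k)^`M(_)]mderiv_comm mderiv_comm.
have d1 : d.+1%:R != 0 :> K by rewrite ((pcharf0P K).1 charK).
apply: (scalerI d1); rewrite eulerM // scaler_sumr.
pose N := M ^+ d.+1.
(* Euler's identity at Mx has been applied to [p]; the induction hypothesis now rewrites each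
   partial derivative at Mx. *)
transitivity (\sum_i linform M i * \sum_j linform N j * p^`M(i)^`M(j)).
  apply: eq_bigr => i _; rewrite scalerAr; congr (_ * _).
  exact: IHd (mderiv_homog i hp) (adjdM i).
transitivity
  (\sum_j linform N j * \sum_k 'X_k * \sum_i M i k *: p^`M(j)^`M(i)).
  under eq_bigr do rewrite mulr_sumr; rewrite exchange_big.
  apply: eq_bigr => j _ /=.
  under [in RHS]eq_bigr do rewrite mulr_sumr.
  rewrite exchange_big mulr_sumr; apply: eq_bigr => i _ /=.
  rewrite mulrCA; congr (_ * _); rewrite mulr_suml; apply: eq_bigr => k _.
  by rewrite mderiv_comm -scalerAl scalerAr.
(* Self-adjointness moves [M] from x to the direction [j]; Euler's identity then absorbs the freed
   x. *)
transitivity (\sum_j linform N j * \sum_i M i j *: (d.+1%:R *: p^`M(i))).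
  apply: eq_bigr => j _; congr (_ * _).
  move/hessian_selfadjP: adjM => adjM; under eq_bigr do rewrite adjM mulr_sumr.
  rewrite exchange_big; apply: eq_bigr => i _ /=.
  rewrite -(euler_homog (mderiv_homog i hp)) scaler_sumr.
  by apply: eq_bigr => k _; rewrite -scalerAr mderiv_comm.
rewrite exprS -mulmxE scaler_sumr; under eq_bigr do rewrite mulr_sumr.
rewrite exchange_big; apply: eq_bigr => i _ /=.
rewrite [linform (M *m _) _]lincombM [in RHS]mulr_suml [in RHS]scaler_sumr.
apply: eq_bigr => j _.
by rewrite -scalerAl -!scalerAr scalerA mulrC -scalerA.
Qed.

End Hessian.

Lemma right_equivalent_gradient (K : closedFieldType) n d (A : 'M[K]_n.+1)
    (f g : {mpoly K[n.+1]}) : [pchar K] =i pred0 ->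
    f \is d.+1.-homog -> g \is d.+1.-homog -> A \in unitmx ->
    (forall i, f^`M(i) = \sum_j A i j *: g^`M(j)) ->
  exists2 B : 'M[K]_n.+1, B \in unitmx & f = g \mPo linsubst B.
Proof.
move=> charK hf hg uA gradf.
have d1 : d.+1%:R != 0 :> K by rewrite ((pcharf0P K).1 charK).
have [|r rA] := unitmx_poly_root d1 (_ : A^T \in unitmx); first by rewrite unitmx_tr.
have adjA : hessian_selfadj g A^T.
  apply/hessian_selfadjP => i k.
  (* Self-adjointness of [A^T] is thus the symmetry of the Hessian of [f]. *)
  have E l m : \sum_j A^T j m *: g^`M(l)^`M(j) = f^`M(m)^`M(l).
    rewrite gradf [RHS]raddf_sum /=; apply: eq_bigr => j _.
    by rewrite mderivZ mxE mderiv_comm.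
  by rewrite !E mderiv_comm.
exists (horner_mx A^T r).
  by rewrite -[_ \in _](@unitrX_pos _ _ d.+1) // rA unitmx_tr.
apply: (scalerI d1); rewrite linsubst_selfadj ?rA //; last first.
  exact: hessian_selfadj_horner.
rewrite -(euler_homog hf); under eq_bigr do rewrite gradf mulr_sumr.
rewrite exchange_big; apply: eq_bigr => j _ /=.
rewrite mulr_suml; apply: eq_bigr => i _.
by rewrite mxE -scalerAl scalerAr.
Qed.

(** * Jacobian ideals and lifting of graded isomorphisms *)

Section MilnorIsomorphism.

Variables (K : fieldType) (n : nat).
Implicit Types (f g p q : {mpoly K[n]}) (L M : 'M[K]_n).

Lemma dhomog1_linform p L i : p \is 1.-homog ->
  (forall j, L i j = p@_U_(j)) -> p = linform L i.
Proof.
by move=> p1 Lp; rewrite {1}(dhomog1E p1); apply: eq_bigr => j _; rewrite Lp.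
Qed.

Lemma mem_jacobian_mderiv f i : f^`M(i) \in jacobian_ideal f.
Proof.
apply/jacobian_idealP; exists (fun j => (i == j)%:R).
rewrite (bigD1 i) //= eqxx mul1r big1 ?addr0 // => j ne.
by rewrite eq_sym (negPf ne) mul0r.
Qed.

Lemma milnor_pi_eq0 f p : milnor_pi f p = 0 <-> p \in jacobian_ideal f.
Proof. by rewrite -(milnor_pi0 f) milnor_piE subr0. Qed.

Lemma jacobian_scale_closed f c p :
  p \in jacobian_ideal f -> c *: p \in jacobian_ideal f.
Proof. by move=> ?; rewrite -mul_mpolyC; apply: jacobian_idealMl. Qed.

(** The generators are homogeneous of degree [d], so taking a component of a combination amounts to
    taking components of its coefficients, and gives 0 below degree [d]. *)
Lemma jacobian_pihomog d k f p : f \is d.+1.-homog ->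
  p \in jacobian_ideal f -> pihomog mdeg k p \in jacobian_ideal f.
Proof.
move=> hf /jacobian_idealP[a ->]; rewrite raddf_sum; apply: rpred_sum => i _ /=.
have hi := mderiv_homog i hf; case: (ltnP k d) => [lt|le].
  by rewrite (pihomogMr_lt _ hi lt) rpred0.
by rewrite -(subnK le) (pihomogMr _ _ hi) jacobian_idealMl // mem_jacobian_mderiv.
Qed.

Lemma jacobian_homogP d f p : f \is d.+1.-homog -> p \is d.-homog ->
  p \in jacobian_ideal f -> exists c : 'I_n -> K, p = \sum_i c i *: f^`M(i).
Proof.
move=> hf hp /jacobian_idealP[a pa]; exists (fun i => (pihomog mdeg 0 (a i))@_0%MM).
rewrite -(pihomog_dE hp) pa raddf_sum; apply: eq_bigr => i _ /=.
rewrite -[d]add0n (pihomogMr _ _ (mderiv_homog i hf)) -mul_mpolyC.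
by rewrite -dhomog0E // pihomogP.
Qed.

(** The transition matrix [C] may be singular if the partial derivatives are linearly dependent. The
    rows of 1 - D C are relations among those of [g], so adding multiples of them to [C] is
    harmless. *)
Lemma gradient_equiv d f g : f \is d.+1.-homog -> g \is d.+1.-homog ->
  (forall i, f^`M(i) \in jacobian_ideal g) ->
  (forall i, g^`M(i) \in jacobian_ideal f) ->
  exists2 A : 'M[K]_n, A \in unitmx &
    forall i, f^`M(i) = \sum_j A i j *: g^`M(j).
Proof.
move=> hf hg fg gf.
have [C fC] : exists C : 'M[K]_n, forall i, f^`M(i) = \sum_j C i j *: g^`M(j).
  have /fin_all_exists[c cE] i := jacobian_homogP hg (mderiv_homog i hf) (fg i).
  by exists (\matrix_(i, j) c i j) => i; rewrite cE; apply: eq_bigr => j _; rewrite mxE.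
have [D gD] : exists D : 'M[K]_n, forall i, g^`M(i) = \sum_j D i j *: f^`M(j).
  have /fin_all_exists[c cE] i := jacobian_homogP hf (mderiv_homog i hg) (gf i).
  by exists (\matrix_(i, j) c i j) => i; rewrite cE; apply: eq_bigr => j _; rewrite mxE.
pose dg j := g^`M(j); pose E := 1%:M - D *m C.
have DC i : lincomb E dg i = 0.
  rewrite lincombB lincombM lincomb1 {1}/dg gD; apply/eqP; rewrite subr_eq0; apply/eqP.
  by apply: eq_bigr => j _; rewrite fC.
have [Z uZ] := unitmx_stable_range D C; exists (C + Z *m E) => // i.
rewrite fC; apply/eqP; rewrite eq_sym -subr_eq0 -(lincombB _ _ dg).
rewrite [C + _]addrC addrK lincombM; apply/eqP/big1 => j _.
by rewrite DC scaler0.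
Qed.

Lemma milnor_morph_linsubst f g (phi : {rmorphism milnor f -> milnor g}) L p :
  scalable phi ->
  (forall i, phi (milnor_pi f 'X_i) = milnor_pi g (linform L i)) ->
  phi (milnor_pi f p) = milnor_pi g (p \mPo linsubst L).
Proof.
move=> phiZ phiX; elim/mpoly_horner_ind: p => [c|p q IHp IHq|i p IHp].
- rewrite comp_mpolyC -[c%:MP]alg_mpolyC !milnor_piZ phiZ.
  by rewrite !milnor_pi1 rmorph1.
- by rewrite milnor_piD rmorphD /= IHp IHq -milnor_piD raddfD.
by rewrite milnor_piM rmorphM /= IHp phiX -milnor_piM rmorphM /= mpolyXU_linsubst.
Qed.

(** [X] collects the linear parts of preimages of the variables. The rows of 1 - X L are linear
    forms in the Jacobian ideal of [g], so correcting [L] by them does not affect the induced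
    map. *)
Lemma milnor_iso_lift d f g (phi : {rmorphism milnor f -> milnor g}) :
  g \is d.+1.-homog -> bijective phi -> scalable phi ->
  (forall k (x : milnor f), milnor_graded k x -> milnor_graded k (phi x)) ->
  exists2 L : 'M[K]_n, L \in unitmx &
    forall p, phi (milnor_pi f p) = milnor_pi g (p \mPo linsubst L).
Proof.
move=> hg [psi _ psiK] phiZ phi_gr.
have [L phiX] : exists L : 'M[K]_n,
    forall i, phi (milnor_pi f 'X_i) = milnor_pi g (linform L i).
  have /fin_all_exists2[q q1 phiq] i : exists2 q : {mpoly K[n]}, q \is 1.-homog &
      phi (milnor_pi f 'X_i) = milnor_pi g q.
    by apply: phi_gr; exists 'X_i => //; apply: mpolyXU_homog.
  exists (\matrix_(i, j) (q i)@_U_(j)) => i.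
  by rewrite phiq; congr milnor_pi; apply: dhomog1_linform => // j; rewrite mxE.
have phiL p := milnor_morph_linsubst p phiZ phiX.
have [X XL] : exists X : 'M[K]_n,
    forall i, linform (1%:M - X *m L) i \in jacobian_ideal g.
  have /fin_all_exists[p pX] i : exists p, milnor_pi g 'X_i = phi (milnor_pi f p).
    by have [p psiX] := milnor_piP (psi (milnor_pi g 'X_i)); exists p; rewrite -psiX psiK.
  (* The representative [p i] may be inhomogeneous; its linear part suffices because the Jacobian
     ideal of [g] is homogeneous. *)
  exists (\matrix_(i, j) (pihomog mdeg 1 (p i))@_U_(j)) => i; set X := \matrix_(_, _) _.
  have /milnor_piE/(jacobian_pihomog 1 hg) := etrans (pX i) (phiL (p i)).
  rewrite raddfB /= pihomog_dE; last exact: mpolyXU_homog.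
  rewrite pihomog_linsubst (@dhomog1_linform _ X i (pihomogP _ _ _)); last first.
    by move=> j; rewrite mxE.
  by rewrite linform_subst [linform (_ - _) i]lincombB lincomb1.
have [Z uZ] := unitmx_stable_range X L.
exists (L + Z *m (1%:M - X *m L)) => // p.
apply: milnor_morph_linsubst => // i; rewrite phiX; apply/milnor_piE.
rewrite -rpredN opprB -lincombB [L + _]addrC addrK lincombM.
by apply: rpred_sum => j _; apply/jacobian_scale_closed/XL.
Qed.

End MilnorIsomorphism.

(** * From graded isomorphism to right equivalence *)

Lemma milnor_graded_iso_right_equivalent (K : closedFieldType) n d
    (f g : {mpoly K[n.+1]}) : [pchar K] =i pred0 ->
  f \is d.+1.-homog -> g \is d.+1.-homog -> milnor_graded_isomorphic f g ->
  right_equivalent f g.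
Proof.
move=> charK hf hg [phi [phi_bij phiZ phi_gr]].
have [L uL phiL] := milnor_iso_lift hg phi_bij phiZ phi_gr.
have memL p : (p \in jacobian_ideal f) = (p \mPo linsubst L \in jacobian_ideal g).
  apply/idP/idP => /milnor_pi_eq0 p0; apply/milnor_pi_eq0.
    by rewrite -phiL p0 rmorph0.
  by apply: (bij_inj phi_bij); rewrite phiL p0 rmorph0.
pose h := f \mPo linsubst L; have hh : h \is d.+1.-homog by apply: linsubst_homog.
have fh : f = h \mPo linsubst (invmx L) by rewrite linsubstM mulmxV // linsubst1.
(* By the chain rule for f = h o L^-1, composing with [L] carries the Jacobian ideal of [f] into
   that of [h]. *)
have fhL i : f^`M(i) \mPo linsubst L \in jacobian_ideal h.
  rewrite {1}fh mderiv_linsubst raddf_sum; apply: rpred_sum => k _ /=.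
  rewrite comp_mpolyZ linsubstM mulVmx // linsubst1.
  exact/jacobian_scale_closed/mem_jacobian_mderiv.
have [i|i|A uA gradh] := @gradient_equiv _ _ d h g hh hg.
- rewrite mderiv_linsubst; apply: rpred_sum => k _; apply: jacobian_scale_closed.
  by rewrite -memL mem_jacobian_mderiv.
(* Pull the derivative of [g] back to the Jacobian ideal of [f], expand it there, and push the
   expansion forward by [fhL]. *)
- have : g^`M(i) \mPo linsubst (invmx L) \in jacobian_ideal f.
    by rewrite memL linsubstM mulVmx // linsubst1 mem_jacobian_mderiv.
  move=> /jacobian_idealP[a /(congr1 (comp_mpoly (linsubst L)))].
  rewrite linsubstM mulVmx // linsubst1 => ->; rewrite raddf_sum.
  by apply: rpred_sum => k _ /=; rewrite rmorphM; apply/jacobian_idealMl/fhL.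
have [B uB hB] := right_equivalent_gradient charK hh hg uA gradh.
exists (B *m invmx L); first by rewrite unitmx_mul uB unitmx_inv.
by rewrite -[RHS]linsubstM -hB.
Qed.

Theorem corollary3p3 (R : realType) (n d : nat)
    (hn : (1 <= n)%N) (hd : (1 <= d)%N)
    (f g : {mpoly (R[i])[n]})
    (hf : f \is d.-homog) (hg : g \is d.-homog)
    (hM : milnor_graded_isomorphic f g) :
  right_equivalent f g.
Proof.
(* A successor [n] gives the matrix ring structure used by [horner_mx]; a successor degree makes the
   partial derivatives homogeneous of its predecessor. *)
case: n hn f g hf hg hM => // n _; case: d hd => // d _ f g hf hg.
by apply: milnor_graded_iso_right_equivalent hf hg; apply: Num.Theory.pchar_num.
Qed.
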